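(* Assume the standing setting (S) of the context. Let $u_0\in\mathsf H_1$ and $0<T<T^*(u_0)$. Then there exist $C>0$ and $n_0\in\mathbb N$ such that for all $n\ge n_0$, with $h_n=T/n$, $$\|\Phi(h_n)u_0-\Phi_n(h_n)u_0\|_{\mathsf H_0}\le C\,h_n^2.$$
   Context: Standing setting (S). $\mathsf H_0,\mathsf H_1$ are complex Hilbert spaces with $\mathsf H_1$ continuously embedded in $\mathsf H_0$. $A$ is a self-adjoint operator in $\mathsf H_1$ which admits a self-adjoint extension in $\mathsf H_0$ (still denoted $A$) whose domain contains $\mathsf H_1$; $\Phi^A(t)=e^{-itA}$ denotes the corresponding unitary groups on $\mathsf H_1$ and $\mathsf H_0$ (they agree on $\mathsf H_1$). $B:\mathsf H_1\to\mathsf H_1$ is locally Lipschitz with $B(0)=0$, and satisfies condition (D): there is a map $B':\mathsf H_1\to\mathcal B(\mathsf H_0)$ such that for all $R,\varepsilon>0$ there exist $C,\delta>0$ with $\|B'(u)\|_{\mathcal B(\mathsf H_0)}\le C$ and $\|B(u+w)-B(u)-B'(u)w\|_{\mathsf H_0}\le\varepsilon\|w\|_{\mathsf H_0}$ for all $u,w\in\mathsf H_1$ with $\|u\|_{\mathsf H_1}\le R$, $\|w\|_{\mathsf H_1}<\delta$. For $u_0\in\mathsf H_1$, $\Phi(t)u_0=u(t)$ is the maximal solution $u\in C([0,T^*(u_0)),\mathsf H_1)$ of $u(t)=\Phi^A(t)u_0-i\int_0^t\Phi^A(t-t')B(u(t'))dt'$. Splitting: $\alpha,\beta:\mathbb R\to\mathbb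 R$ are bounded measurable $1$-periodic functions with $\int_0^1\alpha=\int_0^1\beta=1$; for $T>0$, $n\in\mathbb N$, put $h_n=T/n$, $\alpha_n(t)=\alpha(t/h_n)$, $\beta_n(t)=\beta(t/h_n)$, $\Phi^{A,n}(t_1,t_0)=\Phi^A\big(\int_{t_0}^{t_1}\alpha_n\big)$, and $\Phi_n(t)u_0=u_n(t)$, where $u_n$ is the maximal $C(\,\cdot\,,\mathsf H_1)$ solution of $u_n(t)=\Phi^{A,n}(t,0)u_0-i\int_0^t\beta_n(t')\Phi^{A,n}(t,t')B(u_n(t'))dt'$. It is assumed that, for $T<T^*(u_0)$, $u$ and (for $n$ large) $u_n$ belong to $W^{1,\infty}([0,T],\mathsf H_0)$. *)

(* Defs.v *)
(* Scalars: K := R[i] (complex numbers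
   over an arbitrary R : realType). *)
From HB Require Import structures.
From mathcomp Require Import all_boot all_order all_algebra.
From mathcomp Require Import all_classical all_reals all_analysis.
From mathcomp Require Import complex.
Import Order.TTheory GRing.Theory Num.Theory.
Import numFieldNormedType.Exports.
Set Implicit Arguments. Unset Strict Implicit. Unset Printing Implicit Defensive.
Local Open Scope classical_set_scope.
Local Open Scope ring_scope.
Local Open Scope complex_scope.

Section Defs.
Variable R : realType.
Local Notation K := R[i].
Local Notation leb := (@lebesgue_measure R).

(* ---------- Hilbert spaces ---------- *)
(* [ip] is an inner product on the complete normed K-space [H] (linear in the
   first argument, conjugate-symmetric, inducing the norm of H). *)
Definition is_hilbert (H : completeNormedModType K) (ip : H -> H -> K) : Prop :=
  [/\ (forall a x y z, ip (a *: x + y) z = a * ip x z + ip y z),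
      (forall x y, ip y x = (ip x y)^*) &
      (forall x, `|x| ^+ 2 = ip x x)].

(* bounded (= continuous) linear maps *)
Definition is_linear (V W : lmodType K) (f : V -> W) : Prop :=
  forall a x y, f (a *: x + y) = a *: f x + f y.

(* ---------- (unbounded) self-adjoint operators ---------- *)
(* A partial operator is a pair (D, A) with domain D; values of A outside D
   are irrelevant.  Self-adjointness: D is a dense linear subspace, A is linear
   on D, symmetric, and D(A^* ) is contained in D (hence A = A^* ). *)
Definition selfadjoint (H : completeNormedModType K) (ip : H -> H -> K)
    (D : set H) (A : H -> H) : Prop :=
  D 0 /\ (forall a x y, D x -> D y -> D (a *: x + y)) /\
  (forall a x y, D x -> D y -> A (a *: x + y) = a *: A x + A y) /\
  closure D = setT /\
  (forall x y, D x -> D y -> ip (A x) y = ip x (A y)) /\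
  (forall y z, (forall x, D x -> ip (A x) y = ip x z) -> D y).

(* ---------- the unitary group e^{-itA} ---------- *)
(* Phi is the strongly continuous unitary group whose generator is -iA
   (by Stone's theorem this characterises Phi(t) = e^{-itA} uniquely). *)
Definition unitary_group_of (H : completeNormedModType K)
    (D : set H) (A : H -> H) (Phi : R -> H -> H) : Prop :=
  (forall t, is_linear (Phi t)) /\
  (forall t x, `|Phi t x| = `|x|) /\
  (forall x, Phi 0 x = x) /\
  (forall s t x, Phi (s + t) x = Phi s (Phi t x)) /\
  (forall x, continuous (fun t => Phi t x)) /\
  (forall x, D x <-> exists y : H,
      (fun h : R => (h^-1)%:C *: (Phi h x - x)) @ 0^' --> y) /\
  (forall x, D x ->
      (fun h : R => (h^-1)%:C *: (Phi h x - x)) @ 0^' --> - ('i *: A x)).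

(* ---------- integrals ---------- *)
(* Lebesgue integral of a K-valued function on [a, b] *)
Definition cintegrable (a b : R) (g : R -> K) : Prop :=
  leb.-integrable `[a, b] (fun s => (complex.Re (g s))%:E) /\
  leb.-integrable `[a, b] (fun s => (complex.Im (g s))%:E).

Definition cint (a b : R) (g : R -> K) : K :=
  (Rintegral leb `[a, b] (fun s => complex.Re (g s)))%:C +
  'i * (Rintegral leb `[a, b] (fun s => complex.Im (g s)))%:C.

(* v is the integral over [a,b] of f : R -> H (weak/Pettis sense; coincides
   with the Bochner integral for the strongly measurable integrands used). *)
Definition vintegral (H : completeNormedModType K) (ip : H -> H -> K)
    (a b : R) (f : R -> H) (v : H) : Prop :=
  forall w : H, cintegrable a b (fun s => ip (f s) w) /\
                ip v w = cint a b (fun s => ip (f s) w).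

(* ---------- mild solutions ---------- *)
(* u solves u(t) = Phi(t)u0 - i \int_0^t Phi(t-t') B(u(t')) dt' on [0, tau]. *)
Definition exact_sol (H1 : completeNormedModType K) (ip1 : H1 -> H1 -> K)
    (Phi : R -> H1 -> H1) (B : H1 -> H1) (u0 : H1) (tau : R) (u : R -> H1)
    : Prop :=
  {within `[0, tau], continuous u} /\
  forall t, 0 <= t <= tau -> exists I : H1,
    vintegral ip1 0 t (fun s => Phi (t - s) (B (u s))) I /\
    u t = Phi t u0 - 'i *: I.

(* maximal existence time T^*(u0) *)
Definition Tstar (H1 : completeNormedModType K) (ip1 : H1 -> H1 -> K)
    (Phi : R -> H1 -> H1) (B : H1 -> H1) (u0 : H1) : \bar R :=
  ereal_sup [set tau%:E | tau in
     [set tau : R | 0 <= tau /\ exists u, exact_sol ip1 Phi B u0 tau u]].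

(* splitting data: alpha_n(t) = alpha(t / h_n), h_n = T / n *)
Definition hstep (T : R) (n : nat) : R := T / n%:R.
Definition scaled (alpha : R -> R) (T : R) (n : nat) (t : R) : R :=
  alpha (t / hstep T n).

(* Phi^{A,n}(t1, t0) = Phi^A (\int_{t0}^{t1} alpha_n) *)
Definition PhiAn (H1 : completeNormedModType K) (Phi : R -> H1 -> H1)
    (alpha : R -> R) (T : R) (n : nat) (t1 t0 : R) : H1 -> H1 :=
  Phi (Rintegral leb `[t0, t1] (scaled alpha T n)).

(* u_n solves the splitting equation on [0, tau] *)
Definition split_sol (H1 : completeNormedModType K) (ip1 : H1 -> H1 -> K)
    (Phi : R -> H1 -> H1) (B : H1 -> H1) (alpha beta : R -> R) (T : R)
    (n : nat) (u0 : H1) (tau : R) (u : R -> H1) : Prop :=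
  {within `[0, tau], continuous u} /\
  forall t, 0 <= t <= tau -> exists I : H1,
    vintegral ip1 0 t
      (fun s => (scaled beta T n s)%:C *: PhiAn Phi alpha T n t s (B (u s))) I
    /\ u t = PhiAn Phi alpha T n t 0 u0 - 'i *: I.

(* W^{1,infty}([0,tau], H0) for a continuous function with values in a
   Hilbert space = Lipschitz on [0,tau]. *)
Definition W1inf (H0 : completeNormedModType K) (tau : R) (f : R -> H0)
    : Prop :=
  exists L : R, forall s t, 0 <= s <= tau -> 0 <= t <= tau ->
    `|f t - f s| <= L%:C * `|(t - s)%:C|.

(* admissible splitting coefficient: bounded measurable 1-periodic, mean 1 *)
Definition splitting_coef (alpha : R -> R) : Prop :=
  [/\ measurable_fun setT alpha,
      (exists M : R, forall x, `|alpha x| <= M),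
      (forall x, alpha (x + 1) = alpha x) &
      Rintegral leb `[0, 1] alpha = 1].

End Defs.

(* Main.v *)
Require Import Defs.
From HB Require Import structures.
From mathcomp Require Import all_boot all_order all_algebra.
From mathcomp Require Import all_classical all_reals all_analysis.
From mathcomp Require Import measurable_realfun complex ring lra.
Import Order.TTheory GRing.Theory Num.Theory.
Import numFieldNormedType.Exports.
Local Open Scope classical_set_scope.
Local Open Scope ring_scope.
Local Open Scope complex_scope.

(* The exact flow is itself a splitting scheme, with coefficients identically 1,
   so it suffices to show that one step of any splitting scheme satisfies
     v(h) = Phi(h) u0 - i h B(u0) + O(h^2)   in H0.
   A continuation argument keeps v in a fixed ball of H1, and close to u0, on
   [0, h] for small h.  Since H1 is contained in the domain of A in H0, the orbits
   Phi(t) u0 and Phi(t) B(u0) are Lipschitz in H0 near t = 0; hence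
   |v(s) - u0|_0 = O(h), then |B(v(s)) - B(u0)|_0 = O(h) by condition (D) at u0
   alone, and the integrand differs from beta_n(s) B(u0) by O(h) in H0. *)

(** * Norms with real values *)

Section RealNorm.
Context {R : realType} {V : normedModType R[i]}.
Implicit Types x y : V.

(** Norms here are elements of [R[i]]; by [normE] their real part loses nothing, and estimates
    become inequalities in the ordered field [R]. *)
Definition rnorm x : R := complex.Re `|x|.

Lemma normE x : `|x| = (rnorm x)%:C.
Proof. by rewrite /rnorm RRe_real. Qed.

Lemma rnorm_ge0 x : 0 <= rnorm x.
Proof. by rewrite -ler0c -normE. Qed.

Lemma norm_leE x (r : R) : (`|x| <= r%:C) = (rnorm x <= r).
Proof. by rewrite normE lecR. Qed.

Lemma norm_ltE x (r : R) : (`|x| < r%:C) = (rnorm x < r).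
Proof. by rewrite normE ltcR. Qed.

Lemma rnorm_triangle x y : rnorm (x + y) <= rnorm x + rnorm y.
Proof. by rewrite -lecR rmorphD /= -!normE ler_normD. Qed.

Lemma rnorm0 : rnorm 0 = 0.
Proof. by rewrite /rnorm normr0. Qed.

Lemma rnorm0_eq0 x : rnorm x = 0 -> x = 0.
Proof. by move=> x0; apply/eqP; rewrite -normr_eq0 normE x0. Qed.

Lemma rnormN x : rnorm (- x) = rnorm x.
Proof. by rewrite /rnorm normrN. Qed.

Lemma rnormB x y : rnorm (x - y) <= rnorm x + rnorm y.
Proof. by rewrite (le_trans (rnorm_triangle _ _))// rnormN. Qed.

Lemma rdistC x y : rnorm (x - y) = rnorm (y - x).
Proof. by rewrite -rnormN opprB. Qed.

Lemma rnormZ (a : R) x : rnorm (a%:C *: x) = `|a| * rnorm x.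
Proof. by rewrite /rnorm normrZ normc_def /= expr0n addr0 sqrtr_sqr normE -rmorphM. Qed.

Lemma rnormZi x : rnorm ('i *: x) = rnorm x.
Proof. by rewrite /rnorm normrZ normc_def /= expr0n add0r expr1n sqrtr1 mul1r. Qed.

Lemma rnorm_dist x y : `|rnorm x - rnorm y| <= rnorm (x - y).
Proof.
have := rnorm_triangle (x - y) y; have := rnorm_triangle (y - x) x.
rewrite !subrK (rdistC y x) => h1 h2.
by rewrite ler_norml; apply/andP; split; lra.
Qed.

(** Kept general in the filter so as to serve both continuity at 0 and difference quotients on
    punctured neighbourhoods of 0. *)
Lemma cvg_rnorm (T : Type) (F : set_system T) {FF : Filter F} (f : T -> V) x (e : R) :
  f @ F --> x -> 0 < e -> \forall t \near F, rnorm (x - f t) < e.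
Proof.
move=> /cvgr_dist_lt fx e0.
have e0C : 0 < e%:C :> R[i] by rewrite ltcR.
by apply: filterS (fx _ e0C) => t; rewrite norm_ltE.
Qed.

Lemma rnorm_continuous : continuous (rnorm : V -> R).
Proof.
move=> x; apply/cvgrPdist_lt => e e0.
have FF : Filter (nbhs (x : V)) by exact: (@nbhs_filter V x).
have h : \forall y \near (x : V), rnorm (x - y) < e by exact: cvg_rnorm.
near=> y; apply: le_lt_trans (rnorm_dist _ _) _; near: y; exact: h.
Unshelve. all: by end_near.
Qed.

End RealNorm.

(** * Real inner products and approximate Riesz representation *)

Section RealInnerProduct.
Context {R : realType} {H : completeNormedModType R[i]} {ip : H -> H -> R[i]}.
Hypothesis hil : is_hilbert ip.
Implicit Types x y z : H.

Definition rip (ip : H -> H -> R[i]) x y : R := complex.Re (ip x y).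

Lemma rip_linear (a : R) x y z :
  rip ip (a%:C *: x + y) z = a * rip ip x z + rip ip y z.
Proof.
rewrite /rip; case: hil => -> _ _.
by case: (ip x z) => u v; case: (ip y z) => u' v' /=; rewrite mul0r subr0.
Qed.

Lemma rip0l z : rip ip 0 z = 0.
Proof. by have := rip_linear 1 0 0 z; rewrite scaler0 addr0; lra. Qed.

Lemma ripDl x y z : rip ip (x + y) z = rip ip x z + rip ip y z.
Proof. by rewrite -[x]scale1r (rip_linear 1) mul1r scale1r. Qed.

Lemma ripZl a x z : rip ip (a%:C *: x) z = a * rip ip x z.
Proof. by rewrite -[_ *: x]addr0 rip_linear rip0l addr0. Qed.

Lemma ripNl x z : rip ip (- x) z = - rip ip x z.
Proof.
have -> : - x = (-1)%:C *: x by rewrite rmorphN1 scaleN1r.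
by rewrite ripZl mulN1r.
Qed.

Lemma ripBl x y z : rip ip (x - y) z = rip ip x z - rip ip y z.
Proof. by rewrite ripDl ripNl. Qed.

Lemma ripC x y : rip ip x y = rip ip y x.
Proof. by rewrite /rip; case: hil => _ -> _; case: (ip y x). Qed.

Lemma ripDr x y z : rip ip z (x + y) = rip ip z x + rip ip z y.
Proof. by rewrite !(ripC z) ripDl. Qed.

Lemma ripxx x : rip ip x x = rnorm x ^+ 2.
Proof. by rewrite /rip; case: hil => _ _ <-; rewrite normE -rmorphXn. Qed.

Lemma rnorm_sqrD x y :
  rnorm (x + y) ^+ 2 = rnorm x ^+ 2 + 2 * rip ip x y + rnorm y ^+ 2.
Proof. by rewrite -!ripxx !ripDl !ripDr (ripC y x); lra. Qed.

(** Cauchy-Schwarz, obtained by squaring the triangle inequality of the given norm and expanding. *)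
Lemma rip_le x y : rip ip x y <= rnorm x * rnorm y.
Proof.
have h := rnorm_sqrD x y.
have : rnorm (x + y) ^+ 2 <= (rnorm x + rnorm y) ^+ 2.
  by rewrite lerXn2r ?nnegrE ?addr_ge0 ?rnorm_ge0// rnorm_triangle.
by rewrite h; lra.
Qed.

(* An approximate Riesz representation: minimising [|y|^2 - 2 l y] only up to
   [e^2] avoids extracting a convergent minimising sequence. *)
Lemma approx_riesz (l : H -> R) (c e : R) :
  (forall a x y, l (a%:C *: x + y) = a * l x + l y) ->
  (forall x, l x <= c * rnorm x) -> 0 < e ->
  exists y, forall x, `|rip ip x y - l x| <= e * rnorm x.
Proof.
move=> l_lin l_bd e0.
pose J y := rnorm y ^+ 2 - 2 * l y.
have Jlb y : - c ^+ 2 <= J y.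
  have := l_bd y; have := sqr_ge0 (rnorm y - c).
  by rewrite /J sqrrB; lra.
pose S := [set J y | y in setT].
have hinf : has_inf S.
  split; first by exists (J 0), 0.
  by exists (- c ^+ 2) => _ [y _ <-].
have [_ [y _ <-] Jy] := inf_adherent (exprn_gt0 2 e0) hinf.
exists y => x.
(* Near-minimality of [y] along the line [y + t x] makes this quadratic in [t] nonnegative. *)
have lb t : 0 <= t ^+ 2 * rnorm x ^+ 2 + 2 * t * (rip ip x y - l x) + e ^+ 2.
  have : inf S <= J (t%:C *: x + y).
    by apply: ge_inf; [case: hinf | exists (t%:C *: x + y)].
  rewrite {1}/J rnorm_sqrD l_lin rnormZ exprMn real_normK ?num_real// ripZl.
  by move: Jy; rewrite /J; lra.
set d := rip ip x y - l x in lb *.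
have [x0|xn0] := eqVneq (rnorm x) 0.
  suff -> : d = 0 by rewrite normr0 x0 mulr0.
  have x00 := rnorm0_eq0 x x0.
  rewrite /d x00 rip0l; have := l_lin 1 0 0.
  by rewrite scaler0 addr0; lra.
have xp : 0 < rnorm x by rewrite lt0r xn0 rnorm_ge0.
have e_ge0 := ltW e0.
rewrite -(@ler_pXn2r _ 2) ?nnegrE ?mulr_ge0 ?rnorm_ge0//.
rewrite real_normK ?num_real// exprMn.
(* This [t] minimises the quadratic. *)
have := lb (- d / rnorm x ^+ 2).
have -> : (- d / rnorm x ^+ 2) ^+ 2 * rnorm x ^+ 2 + 2 * (- d / rnorm x ^+ 2) * d + e ^+ 2
  = e ^+ 2 - d ^+ 2 / rnorm x ^+ 2 by field.
by rewrite subr_ge0 ler_pdivrMr ?exprn_gt0.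
Qed.

End RealInnerProduct.

(** * Integrals over intervals and change of scale *)

Section Integrals.
Context {R : realType}.
Local Notation leb := (@lebesgue_measure R).

Lemma bounded_itv_integrable (f : R -> R) (M a b : R) :
  measurable_fun setT f -> (forall x, `|f x| <= M) ->
  leb.-integrable `[a, b] (EFin \o f).
Proof.
move=> mf fM; apply: measurable_bounded_integrable => //=.
- rewrite lebesgue_measure_itv/=.
  by case: ifPn => // _; rewrite -EFinB ltry.
- exact: measurable_funTS.
- exists M; split; first exact: num_real.
  by move=> x Mx t _ /=; rewrite (le_trans (fM _))// ltW.
Qed.

Lemma Rintegral_itv_cst (a b r : R) : a <= b ->
  Rintegral leb `[a, b] (fun=> r) = r * (b - a).
Proof.
move=> ab; rewrite Rintegral_cst//= lebesgue_measure_itv/=.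
rewrite lte_fin; case: ltP => [_//|ba].
by rewrite /= (_ : b = a) ?subrr//; apply/eqP; rewrite eq_le ab ba.
Qed.

Lemma integrable_itv_cst (a b r : R) : leb.-integrable `[a, b] (EFin \o (fun=> r)).
Proof. by apply: (@bounded_itv_integrable _ `|r|). Qed.

Lemma Rintegral_itv_le (f : R -> R) (a b c : R) : a <= b ->
  leb.-integrable `[a, b] (EFin \o f) -> (forall x, a <= x <= b -> f x <= c) ->
  Rintegral leb `[a, b] f <= c * (b - a).
Proof.
move=> ab fi fc; rewrite -Rintegral_itv_cst//.
by apply: le_Rintegral => //; exact: integrable_itv_cst.
Qed.

Lemma Rintegral_itv_abs_le (f : R -> R) (M a b : R) :
  measurable_fun setT f -> (forall x, `|f x| <= M) -> a <= b ->
  `|Rintegral leb `[a, b] f| <= M * (b - a).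
Proof.
move=> mf fM ab; have fi := bounded_itv_integrable f M a b mf fM.
apply: le_trans (le_normr_Rintegral _ fi) _; first by [].
by apply: Rintegral_itv_le => //; exact: integrable_norm.
Qed.

(** The preimage of []a, b]] is []a h, b h]], so the pushforward divided by [h] agrees with Lebesgue
    measure on half-open intervals, hence everywhere by uniqueness. *)
Lemma lebesgue_measure_scale (h : R) (A : set R) : 0 < h -> measurable A ->
  pushforward leb (fun x : measurableTypeR R => x / h : measurableTypeR R) A
  = (h%:E * leb A)%E.
Proof.
move=> h0 mA.
have mphi : measurable_fun setT (fun x : measurableTypeR R => x / h : measurableTypeR R).
  by apply: measurable_funM.
pose phi (x : measurableTypeR R) : measurableTypeR R := x / h.
have hi : 0 <= h^-1 by rewrite invr_ge0 ltW.
pose P : {measure set (measurableTypeR R) -> \bar R} :=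
  measure_function_pushforward__canonical__measure_function_Measure leb mphi.
pose mu := mscale (NngNum hi) P.
suff -> : leb A = mu A.
  rewrite /mu /mscale/= muleA -EFinM divff ?gt_eqF// mul1e //.
apply: lebesgue_measure_unique => //= _ [[a b]] _ <-.
rewrite /mu /mscale /= /pushforward.
have -> : (phi @^-1` `]a, b]) = `](a * h), (b * h)]%classic.
  apply/seteqP; split => x /=; rewrite !in_itv/=;
  by rewrite ltr_pdivlMr// ler_pdivrMr.
rewrite !lebesgue_measure_itv/= !lte_fin ltr_pM2r//.
case: ifPn => _; last by rewrite mule0.
by rewrite -!EFinB -EFinM; congr EFin; field; rewrite gt_eqF.
Qed.

Lemma Rintegral_scale (f : R -> R) (M h : R) : 0 < h ->
  measurable_fun setT f -> (forall x, `|f x| <= M) ->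
  Rintegral leb `[0, h] (fun t : R => f (t / h)) = h * Rintegral leb `[0, 1] f.
Proof.
move=> h0 mf fM.
have mphi : measurable_fun setT (fun x : measurableTypeR R => x / h : measurableTypeR R).
  by apply: measurable_funM.
have mfh : measurable_fun setT (fun t : R => f (t / h)) by exact: measurableT_comp.
have ge0_case (g : R -> R) : measurable_fun setT g -> (forall x, 0 <= g x) ->
    Rintegral leb `[0, h] (fun t : R => g (t / h)) = h * Rintegral leb `[0, 1] g.
  move=> mg g0; rewrite /Rintegral.
  have -> : `[0, h]%classic =
      (fun x : measurableTypeR R => x / h : measurableTypeR R) @^-1` `[0, 1]%classic.
    apply/seteqP; split => x /=; rewrite !in_itv/=;
    by rewrite ler_pdivlMr// ler_pdivrMr// mul0r mul1r.
  rewrite -(ge0_integral_pushforward mphi leb (f := EFin \o g))//; first last.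
  - by move=> x _; rewrite lee_fin.
  - by apply/measurable_EFinP; exact: measurable_funTS.
  transitivity (fine (\int[mscale (NngNum (ltW h0)) leb]_(x in `[0%R, 1%R]) (g x)%:E)%E).
    congr fine; apply: eq_measure_integral => A mA _.
    exact: lebesgue_measure_scale.
  rewrite ge0_integral_mscale//=; first last.
    - by move=> x _; rewrite lee_fin.
    - by apply/measurable_EFinP; exact: measurable_funTS.
  have : (0 <= \int[leb]_(x in `[0%R, 1%R]) (g x)%:E)%E.
    by apply: integral_ge0 => x _; rewrite lee_fin.
  (* The integral may be [+oo]; [fine] sends it to 0, so both sides vanish. *)
  case: (X in (0 <= X)%E -> _) => [r||]//= _.
  by rewrite mulr0 gt0_muley ?lte_fin.
(* The shift by [M] makes the function nonnegative; its contribution [M * h] cancels. *)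
have := ge0_case (fun x => f x + M).
rewrite RintegralD//; [|exact: (bounded_itv_integrable _ M)|exact: integrable_itv_cst].
rewrite RintegralD//; [|exact: (bounded_itv_integrable _ M)|exact: integrable_itv_cst].
rewrite !Rintegral_itv_cst ?(ltW h0)// => H.
have {}H := H (measurable_funD mf (measurable_cst _)) _.
have : forall x, 0 <= f x + M by move=> x; have := fM x; rewrite ler_norml; lra.
by move=> /H; lra.
Qed.

End Integrals.

(** * Weak integrals of vector-valued functions *)

Section WeakIntegral.
Context {R : realType} {H : completeNormedModType R[i]} {ip : H -> H -> R[i]}.
Hypothesis hil : is_hilbert ip.
Local Notation leb := (@lebesgue_measure R).

(* The real part of [vintegral], which already determines the integral since
   the real part of an inner product does. *)
Definition rvintegral (ip : H -> H -> R[i]) (a b : R) (f : R -> H) (v : H) : Prop :=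
  forall w, leb.-integrable `[a, b] (EFin \o (fun s => rip ip (f s) w)) /\
            rip ip v w = Rintegral leb `[a, b] (fun s => rip ip (f s) w).

Lemma vintegralW a b f v : vintegral ip a b f v -> rvintegral ip a b f v.
Proof.
move=> fv w; have [[fi _] vw] := fv w; split; first exact: fi.
by rewrite {1}/rip vw /cint /= !mul0r mul1r subr0 addr0.
Qed.

Lemma rvintegralB a b f g v w :
  rvintegral ip a b f v -> rvintegral ip a b g w ->
  rvintegral ip a b (fun s => f s - g s) (v - w).
Proof.
move=> fv gw z; have [fi vz] := fv z; have [gi wz] := gw z.
have e : (fun s => rip ip (f s - g s) z) = (fun s => rip ip (f s) z - rip ip (g s) z).
  by apply/funext => s; rewrite ripBl.
rewrite e; split; last by rewrite ripBl// vz wz RintegralB.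
have -> : EFin \o (fun s => rip ip (f s) z - rip ip (g s) z)
  = (fun s => ((EFin \o (fun s => rip ip (f s) z)) s - (EFin \o (fun s => rip ip (g s) z)) s)%E).
  by apply/funext => s; rewrite /= EFinB.
exact: integrableB.
Qed.

Lemma rvintegralZ a b (c : R -> R) (M : R) (x : H) :
  measurable_fun setT c -> (forall s, `|c s| <= M) ->
  rvintegral ip a b (fun s => (c s)%:C *: x) ((Rintegral leb `[a, b] c)%:C *: x).
Proof.
move=> mc cM w.
have ci := bounded_itv_integrable c M a b mc cM.
have e : (fun s => rip ip ((c s)%:C *: x) w) = (fun s => c s * rip ip x w).
  by apply/funext => s; rewrite ripZl.
rewrite e ripZl// RintegralZr//; split => //.
apply: (@bounded_itv_integrable _ _ (M * `|rip ip x w|)).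
  exact: measurable_funM.
by move=> s; rewrite normrM ler_wpM2r.
Qed.

(** Testing the weak integral against [v] itself bounds the square of its norm by [M * (b - a)]
    times its norm. *)
Lemma rvintegral_norm_le a b f v (M : R) : a <= b ->
  rvintegral ip a b f v -> (forall s, a <= s <= b -> rnorm (f s) <= M) ->
  rnorm v <= M * (b - a).
Proof.
move=> ab fv fM; have [fi vv] := fv v.
have [->|v0] := eqVneq (rnorm v) 0.
  rewrite mulr_ge0 ?subr_ge0// (le_trans (rnorm_ge0 _) (fM a _))//.
  by rewrite lexx.
have vp : 0 < rnorm v by rewrite lt0r v0 rnorm_ge0.
rewrite -(ler_pM2r vp) -expr2 -(ripxx hil) vv.
rewrite mulrAC; apply: Rintegral_itv_le => // s /fM h.
by rewrite (le_trans (rip_le hil _ _))// ler_wpM2r// ltW.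
Qed.

End WeakIntegral.

(* [G] is only a weak integral in [H1]; the bound on the image is transported to
   the weaker norm by approximating the functional [x |-> <k x, k G>_0] on [H1]
   by inner products of [H1]. *)
Lemma rvintegral_image_norm_le {R : realType} {H0 H1 : completeNormedModType R[i]}
  {ip0 : H0 -> H0 -> R[i]} {ip1 : H1 -> H1 -> R[i]} (k : H1 -> H0) (c : R)
  (g : R -> H1) (G : H1) (a b M0 M1 : R) :
  is_hilbert ip0 -> is_hilbert ip1 -> is_linear k ->
  (forall x, rnorm (k x) <= c * rnorm x) ->
  a <= b -> rvintegral ip1 a b g G ->
  (forall s, a <= s <= b -> rnorm (g s) <= M1) ->
  (forall s, a <= s <= b -> rnorm (k (g s)) <= M0) ->
  rnorm (k G) <= M0 * (b - a).
Proof.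
move=> hil0 hil1 k_lin kc ab gG gM1 gM0.
have aI : a <= a <= b by rewrite lexx.
have M0ge0 : 0 <= M0 := le_trans (rnorm_ge0 _) (gM0 a aI).
have M1ge0 : 0 <= M1 := le_trans (rnorm_ge0 _) (gM1 a aI).
have [->|v0] := eqVneq (rnorm (k G)) 0; first by rewrite mulr_ge0 ?subr_ge0.
have vp : 0 < rnorm (k G) by rewrite lt0r v0 rnorm_ge0.
pose l x := rip ip0 (k x) (k G).
have l_lin t x y : l (t%:C *: x + y) = t * l x + l y.
  by rewrite /l k_lin rip_linear.
have l_bd x : l x <= (c * rnorm (k G)) * rnorm x.
  rewrite (le_trans (rip_le hil0 _ _))// mulrAC ler_wpM2r ?rnorm_ge0//.
pose D := rnorm G + M1 * (b - a).
have D0 : 0 <= D by rewrite addr_ge0 ?rnorm_ge0// mulr_ge0// subr_ge0.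
(* Replacing [l] by the inner product with [y] costs [e] times the norm at [G], and at each [g s]
   under the integral; [D] collects both costs. *)
have bound e : 0 < e -> rnorm (k G) ^+ 2 <= M0 * (b - a) * rnorm (k G) + e * D.
  move=> e0; have [y yP] := approx_riesz hil1 l _ e l_lin l_bd e0.
  have [gi Gy] := gG y.
  have : rip ip1 G y <= (M0 * rnorm (k G) + e * M1) * (b - a).
    rewrite Gy; apply: Rintegral_itv_le => // s sI.
    have := yP (g s); rewrite ler_norml => /andP[_].
    have : l (g s) <= M0 * rnorm (k G).
      by rewrite (le_trans (rip_le hil0 _ _))// ler_wpM2r ?rnorm_ge0// gM0.
    have : e * rnorm (g s) <= e * M1 by rewrite ler_wpM2l ?gM1// ltW.
    by lra.
  have := yP G; rewrite ler_norml => /andP[+ _].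
  by rewrite /l ripxx// /D; lra.
rewrite -(ler_pM2r vp) -expr2; apply/ler_addgt0Pr => e e0.
have D1 : 0 < D + 1 by lra.
(* Adding 1 keeps the denominator positive even when [D = 0]. *)
apply: le_trans (bound (e / (D + 1)) _) _; first by rewrite divr_gt0.
rewrite lerD2l mulrAC ler_pdivrMr// ler_wpM2l// ?(ltW e0)//; lra.
Qed.

(* Continuation argument: a continuous function can leave [0, r] only by
   taking the value [r] a first time. *)
Lemma bootstrap_bound {R : realType} (f : R -> R) (h r : R) : 0 <= h ->
  {within `[0, h], continuous f} -> f 0 < r ->
  (forall t, 0 <= t <= h -> (forall s, 0 <= s <= t -> f s <= r) -> f t < r) ->
  forall t, 0 <= t <= h -> f t <= r.
Proof.
move=> h0 fc f0r step t /andP[t0 th]; rewrite leNgt; apply/negP => rt.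
(* By the intermediate value theorem, any time at or above level [r] is preceded by a time exactly
   at level [r]. *)
have cross s : 0 <= s <= h -> r <= f s -> exists2 c, 0 <= c <= s & f c = r.
  move=> /andP[s0 sh] rs.
  have [||c cI fcr] := @IVT _ f 0 s r s0.
  - apply: continuous_subspaceW fc => x /=; rewrite !in_itv/= => /andP[-> xs].
    exact: le_trans xs sh.
  - by rewrite ge_min le_max (ltW f0r) rs orbT.
  - by exists c => //; move: cI; rewrite in_itv.
pose A := [set s | 0 <= s <= h /\ f s = r].
have hinf : has_inf A.
  split; last by exists 0 => s [/andP[]].
  have [|c /andP[c0 ct] fcr] := cross t _ (ltW rt); first by rewrite t0.
  by exists c; split => //; rewrite c0 (le_trans ct th).
have clA : closed A.
  have -> : A = `[0, h] `&` f @^-1` [set r].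
    by apply/seteqP; split => x [xI fx]; split => //; move: xI; rewrite /= in_itv.
  rewrite setIC closed_setIS; last exact: itv_closed.
  by move/continuous_closedP: fc; apply; exact: closed_eq.
have [mI fm] : A (inf A).
  apply: itv_closed_infimums => //; first by case: hinf.
  split; first by move=> x Ax; apply: ge_inf Ax; case: hinf.
  by move=> x lbx; apply: lb_le_inf lbx; case: hinf.
(* At the first hitting time, [step] contradicts [f = r]: an earlier value above [r] would force an
   earlier crossing. *)
have : f (inf A) < r; last by rewrite fm ltxx.
apply: step => // s /andP[s0 sm]; rewrite leNgt; apply/negP => rs.
have sh : s <= h by case/andP: mI => _; exact: le_trans.
have [|c /andP[c0 cs] fcr] := cross s _ (ltW rs); first by rewrite s0.
have cm : inf A <= c.
  by apply: ge_inf; [case: hinf|split => //; rewrite c0 (le_trans cs)].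
have : s = inf A by apply/eqP; rewrite eq_le sm (le_trans cm cs).
by move=> sE; move: rs; rewrite sE fm ltxx.
Qed.

(** * Linear maps *)

Section Linear.
Context {R : realType} {V W : lmodType R[i]} {k : V -> W}.
Hypothesis k_lin : is_linear k.

Lemma is_linearD x y : k (x + y) = k x + k y.
Proof. by have := k_lin 1 x y; rewrite !scale1r. Qed.

Lemma is_linear0 : k 0 = 0.
Proof. by apply: (addrI (k 0)); rewrite -is_linearD !addr0. Qed.

Lemma is_linearZ a x : k (a *: x) = a *: k x.
Proof. by have := k_lin a x 0; rewrite is_linear0 !addr0. Qed.

Lemma is_linearB x y : k (x - y) = k x - k y.
Proof. by rewrite is_linearD -scaleN1r is_linearZ scaleN1r. Qed.

End Linear.

(** * Displacement under a unitary group near time 0 *)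

Section UnitaryGroup.
Context {R : realType} {H : completeNormedModType R[i]} {D : set H} {A : H -> H}.
Context {Phi : R -> H -> H}.
Hypothesis gr : unitary_group_of D A Phi.

Lemma unitary_rnorm t x : rnorm (Phi t x) = rnorm x.
Proof. by case: gr => _ [Phi_iso _]; rewrite /rnorm Phi_iso. Qed.

Lemma unitary_continuous0 x e : 0 < e ->
  exists2 eta, 0 < eta & forall t, `|t| < eta -> rnorm (Phi t x - x) < e.
Proof.
case: gr => _ [_ [Phi0 [_ [Phic _]]]] e0.
have : \forall t \near (0 : R), rnorm (Phi 0 x - Phi t x) < e.
  exact: (@cvg_rnorm R H R (nbhs (0 : R)) _ (fun t => Phi t x) _ e (Phic x 0) e0).
move=> /nbhs_ballP[eta /= eta0 Heta]; exists eta => // t teta.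
have : ball (0 : R) eta t by rewrite /ball /= sub0r normrN.
by move=> /Heta; rewrite Phi0 rdistC.
Qed.

(** On the domain the difference quotient tends to [- i A x], so near 0 its norm is below that of
    [A x] plus 1. *)
Lemma unitary_lipschitz0 x : D x ->
  exists eta K, [/\ 0 < eta, 0 <= K &
    forall t, `|t| < eta -> rnorm (Phi t x - x) <= K * `|t|].
Proof.
case: gr => _ [_ [Phi0 [_ [_ [_ dPhi]]]]] /dPhi dx.
have : \forall t \near (0 : R)^',
    rnorm (- ('i *: A x) - (t^-1)%:C *: (Phi t x - x)) < 1.
  exact: (@cvg_rnorm R H R (0 : R)^' _ _ _ 1 dx ltr01).
move=> /nbhs_ballP[eta /= eta0 Heta].
exists eta, (rnorm (A x) + 1); split => //; first by rewrite addr_ge0 ?rnorm_ge0.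
move=> t teta; have [->|t0] := eqVneq t 0.
  by rewrite Phi0 subrr rnorm0 normr0 mulr0.
have : ball (0 : R) eta t by rewrite /ball /= sub0r normrN.
move=> /Heta /(_ t0); set d := Phi t x - x => dlt.
have tp : 0 < `|t| by rewrite normr_gt0.
rewrite -ler_pdivrMr// mulrC -normfV -rnormZ.
have := rnorm_triangle ((t^-1)%:C *: d - - ('i *: A x)) (- ('i *: A x)).
rewrite subrK rnormN rnormZi (rdistC _ (- _)).
by lra.
Qed.

End UnitaryGroup.

(** * The exact flow as a splitting scheme, and small steps *)

Lemma vintegral_ext {R : realType} {H : completeNormedModType R[i]}
    (ip : H -> H -> R[i]) (a b : R) (f g : R -> H) (v : H) :
  (forall s, a <= s <= b -> f s = g s) ->
  vintegral ip a b f v -> vintegral ip a b g v.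
Proof.
move=> fg fv w; have [[fRe fIm] vw] := fv w.
have e s : s \in `[a, b]%classic -> ip (f s) w = ip (g s) w.
  by rewrite inE /= in_itv/= => /fg ->.
split; first split.
- by apply: eq_integrable fRe => // s /e ->.
- by apply: eq_integrable fIm => // s /e ->.
rewrite vw /cint; congr (_%:C + 'i * _%:C); apply: eq_Rintegral => s /e -> //.
Qed.

Lemma splitting_coef1 (R : realType) : splitting_coef (fun=> 1 : R).
Proof.
split => //; first by exists 1 => _; rewrite normr1.
by rewrite Rintegral_itv_cst// subr0 mulr1.
Qed.

Lemma exact_sol_split {R : realType} {H : completeNormedModType R[i]}
    (ip : H -> H -> R[i]) (Phi : R -> H -> H) (B : H -> H) (T : R) n u0 tau u :
  exact_sol ip Phi B u0 tau u ->
  split_sol ip Phi B (fun=> 1) (fun=> 1) T n u0 tau u.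
Proof.
move=> [uc uI]; split => // t tI; have [I [IP ut]] := uI t tI.
have t0 : 0 <= t by case/andP: tI.
exists I; split; last by rewrite ut /PhiAn /scaled Rintegral_itv_cst// subr0 mul1r.
(* Agreement of the integrands is available for [s <= t]; beyond, [[s, t]] is empty and its integral
   is 0, not [t - s]. *)
apply: vintegral_ext IP => s /andP[_ st].
by rewrite /PhiAn /scaled Rintegral_itv_cst// mul1r scale1r.
Qed.

Lemma hstep_small {R : realType} (T eta : R) : 0 < T -> 0 < eta ->
  exists n0, forall n, (n0 <= n)%N -> 0 < hstep T n < eta.
Proof.
move=> T0 eta0; have q0 : 0 < T / eta by rewrite divr_gt0.
exists (Num.bound (T / eta)) => n n0n.
have qn : T / eta < n%:R.
  by apply: lt_le_trans (archi_boundP (ltW q0)) _; rewrite ler_nat.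
have np : 0 < n%:R :> R by exact: lt_trans qn.
by rewrite /hstep divr_gt0//= ltr_pdivrMr// mulrC -ltr_pdivrMr.
Qed.

(** * First-order expansion of one splitting step *)

Section SplittingStep.
Context {R : realType} {H0 H1 : completeNormedModType R[i]}.
Context {ip0 : H0 -> H0 -> R[i]} {ip1 : H1 -> H1 -> R[i]}.
Hypotheses (hil0 : is_hilbert ip0) (hil1 : is_hilbert ip1).
Context {iota : H1 -> H0} {c : R}.
Hypotheses (iota_lin : is_linear iota)
  (iota_bdd : forall x, rnorm (iota x) <= c * rnorm x).
Context {D1 : set H1} {A1 : H1 -> H1} {D0 : set H0} {A0 : H0 -> H0}.
Hypothesis dom01 : forall x, D0 (iota x).
Context {Phi1 : R -> H1 -> H1} {Phi0 : R -> H0 -> H0}.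
Hypotheses (gr1 : unitary_group_of D1 A1 Phi1) (gr0 : unitary_group_of D0 A0 Phi0)
  (agree : forall t x, Phi0 t (iota x) = iota (Phi1 t x)).
Context {B : H1 -> H1} {u0 : H1} {b Cd delta : R}.
Hypotheses (b0 : 0 < b) (Cd0 : 0 <= Cd) (delta0 : 0 < delta)
  (B_bdd : forall x, rnorm x <= rnorm u0 + 1 -> rnorm (B x) <= b)
  (B_lip0 : forall w, rnorm w < delta ->
     rnorm (iota (B (u0 + w)) - iota (B u0)) <= Cd * rnorm (iota w)).
Context {alpha beta : R -> R}.
Hypotheses (alpha_ok : splitting_coef alpha) (beta_ok : splitting_coef beta).
Context {T : R}.
Hypothesis T0 : 0 < T.

(** Both coefficients have mean 1 over the single period [[0, h]], so the first-order part is the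
    same for every scheme. *)
Lemma split_step_expansion : exists C n0, 0 <= C /\ forall n, (n0 <= n)%N ->
  forall v, split_sol ip1 Phi1 B alpha beta T n u0 (hstep T n) v ->
  rnorm (iota (v (hstep T n)) -
         iota (Phi1 (hstep T n) u0 - 'i *: ((hstep T n)%:C *: B u0)))
    <= C * hstep T n ^+ 2.
Proof.
have iota_le x y : rnorm x <= y -> rnorm (iota x) <= `|c| * y.
  move=> xy; apply: le_trans (iota_bdd x) _; apply: le_trans (ler_norm _) _.
  by rewrite normrM (ger0_norm (rnorm_ge0 _)) ler_wpM2l.
have [M [M0 alphaM betaM]] : exists M, [/\ 0 < M, forall x, `|alpha x| <= M &
    forall x, `|beta x| <= M].
  case: alpha_ok beta_ok => _ [Ma Ha] _ _ [_ [Mb Hb] _ _].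
  exists (`|Ma| + `|Mb| + 1); split.
  - by rewrite ltr_wpDl// addr_ge0.
  - by move=> x; apply: le_trans (Ha x) _; have := ler_norm Ma; have := normr_ge0 Mb; lra.
  - by move=> x; apply: le_trans (Hb x) _; have := ler_norm Mb; have := normr_ge0 Ma; lra.
have d20 : 0 < delta / 2 by rewrite divr_gt0.
have [ea ea0 Ha] := unitary_continuous0 gr1 u0 _ d20.
have [eb [Kb [eb0 Kb0 Hb]]] := unitary_lipschitz0 gr0 _ (dom01 u0).
have [ec [Kc [ec0 Kc0 Hc]]] := unitary_lipschitz0 gr0 _ (dom01 (B u0)).
(* For [h < eta], [M h] stays within the three radii of the group estimates, and the Duhamel term,
   at most [M b h] in H1, stays below 1/2 and [delta / 2]. *)
pose eta := Num.min (Num.min ea (Num.min eb ec) / M) (Num.min (1 / 2) (delta / 2) / (M * b)).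
have eta0 : 0 < eta.
  rewrite lt_min; apply/andP; split; apply: divr_gt0; rewrite ?mulr_gt0//.
    by rewrite !lt_min ea0 eb0.
  by rewrite lt_min d20 divr_gt0.
have [n0 Hn0] := hstep_small T eta T0 eta0.
(* [C1 h] bounds the H0 distance of [v] to [u0]: orbit displacement plus Duhamel term. *)
pose C1 := Kb * M + `|c| * (M * b).
have C10 : 0 <= C1 by rewrite addr_ge0// mulr_ge0// ?ltW// mulr_gt0.
(* [M] bounds [beta], [Cd * C1] comes from the variation of [B] along [v], and [Kc * M] from the
   orbit of [B u0]. *)
pose C2 := M * (Cd * C1 + Kc * M).
have C20 : 0 <= C2 by rewrite mulr_ge0 ?addr_ge0 ?mulr_ge0// ltW.
exists C2, n0; split => // n /Hn0; set h := hstep T n => /andP[h0 heta] v [vc vI].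
have Mh : M * h < Num.min ea (Num.min eb ec).
  by move: heta; rewrite lt_min ltr_pdivlMr// mulrC => /andP[].
have [Mha Mhb Mhc] : [/\ M * h < ea, M * h < eb & M * h < ec].
  by move: Mh; rewrite !lt_min => /and3P[].
have [Mbh1 Mbhd] : M * b * h < 1 / 2 /\ M * b * h < delta / 2.
  move: heta; rewrite lt_min => /andP[_]; rewrite ltr_pdivlMr ?mulr_gt0// mulrC.
  by rewrite lt_min => /andP[].
pose a_ := scaled alpha T n; pose b_ := scaled beta T n.
have ma : measurable_fun setT a_.
  case: alpha_ok => ma _ _ _; apply: measurableT_comp => //.
  exact: mulrr_measurable.
have mb : measurable_fun setT b_.
  case: beta_ok => mb _ _ _; apply: measurableT_comp => //.
  exact: mulrr_measurable.
have inth (f : R -> R) : splitting_coef f -> (forall x, `|f x| <= M) ->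
    Rintegral (@lebesgue_measure R) `[0, h] (scaled f T n) = h.
  move=> [mf _ _ f1] fM.
  by have := Rintegral_scale f M h h0 mf fM; rewrite f1 mulr1.
pose sigma t s := Rintegral (@lebesgue_measure R) `[s, t] a_.
have sigmaM t s : 0 <= s <= t -> t <= h -> `|sigma t s| <= M * h.
  move=> /andP[s0 st] th.
  apply: le_trans (Rintegral_itv_abs_le a_ M s t ma (fun x => alphaM _) st) _.
  by rewrite ler_wpM2l ?(ltW M0)//; lra.
pose F t s := (b_ s)%:C *: Phi1 (sigma t s) (B (v s)).
have {}vI t : 0 <= t <= h ->
    exists2 I, rvintegral ip1 0 t (F t) I & v t = Phi1 (sigma t 0) u0 - 'i *: I.
  by move=> /vI[I [/vintegralW IP vt]]; exists I.
have F_le t s : rnorm (v s) <= rnorm u0 + 1 -> rnorm (F t s) <= M * b.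
  move=> vs; rewrite rnormZ (unitary_rnorm gr1).
  by rewrite ler_pM ?rnorm_ge0 ?B_bdd//; exact: betaM.
have I_le t I : 0 <= t <= h -> rvintegral ip1 0 t (F t) I ->
    (forall s, 0 <= s <= t -> rnorm (v s) <= rnorm u0 + 1) ->
    rnorm I <= M * b * h.
  move=> /andP[t0 th] IP vs.
  apply: le_trans (rvintegral_norm_le hil1 0 t (F t) I (M * b) t0 IP _) _.
    by move=> s /vs; exact: F_le.
  by rewrite subr0 ler_wpM2l// mulr_ge0 ?ltW.
have hh : 0 <= h <= h by rewrite lexx ltW.
have v_le : forall t, 0 <= t <= h -> rnorm (v t) <= rnorm u0 + 1.
  apply: bootstrap_bound => //; first exact: ltW.
  - by move=> x; apply: continuous_comp; [exact: vc | exact: rnorm_continuous].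
  - have [|I IP ->] := vI 0; first by rewrite lexx ltW.
    have I0 : rnorm I <= rnorm (F 0 0) * (0 - 0).
      apply: (rvintegral_norm_le hil1) IP _ => // s /andP[s0 s0'].
      by rewrite (_ : s = 0)//; apply/eqP; rewrite eq_le s0 s0'.
    apply: le_lt_trans (rnormB _ _) _; rewrite (unitary_rnorm gr1) rnormZi.
    by move: I0; rewrite subrr mulr0; lra.
  (* The strict gain: staying in the ball of radius [rnorm u0 + 1] up to [t] forces the norm at [t]
     below [rnorm u0 + 1/2]. *)
  - move=> t tI vs; have [I IP ->] := vI t tI.
    apply: le_lt_trans (rnormB _ _) _; rewrite (unitary_rnorm gr1) rnormZi.
    by have := I_le t I tI IP vs; lra.
have {}I_le t I : 0 <= t <= h -> rvintegral ip1 0 t (F t) I -> rnorm I <= M * b * h.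
  move=> tI IP; apply: (I_le t) => // s /andP[s0 st]; apply: v_le.
  by rewrite s0 (le_trans st)//; case/andP: tI.
have v_near t : 0 <= t <= h ->
    rnorm (v t - u0) < delta /\ rnorm (iota (v t - u0)) <= C1 * h.
  move=> tI; have [I IP ->] := vI t tI; have Ile := I_le t I tI IP.
  have st : `|sigma t 0| <= M * h by case/andP: (tI) => t0 th; rewrite sigmaM ?lexx.
  (* The deviation is the displacement of [u0] minus [i I]; in H1 each is below [delta / 2], in H0
     each gives one term of [C1]. *)
  rewrite addrAC; split.
    apply: le_lt_trans (rnormB _ _) _; rewrite rnormZi.
    have := Ha (sigma t 0) (le_lt_trans st Mha); lra.
  rewrite (is_linearB iota_lin) (is_linearZ iota_lin).
  apply: le_trans (rnormB _ _) _; rewrite rnormZi (is_linearB iota_lin) -agree.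
  have := Hb (sigma t 0) (le_lt_trans st Mhb).
  have : Kb * `|sigma t 0| <= Kb * (M * h) by rewrite ler_wpM2l.
  have := iota_le I _ Ile.
  rewrite /C1; lra.
have [I IP ->] := vI h hh.
(* Subtracting [b_ s *: B u0], whose integral is [h *: B u0], leaves an integrand of size [O(h)] in
   H0. *)
have GP := rvintegralB hil1 0 h (F h) _ I _ IP
  (rvintegralZ hil1 0 h b_ M (B u0) mb (fun x => betaM _)).
rewrite inth// in GP; set G := (I - _) in GP.
have -> : sigma h 0 = h by exact: inth.
rewrite -(is_linearB iota_lin).
have -> : Phi1 h u0 - 'i *: I - (Phi1 h u0 - 'i *: (h%:C *: B u0)) = - ('i *: G).
  by rewrite /G scalerBr [RHS]opprB opprB addrC addrA subrK.
rewrite -[X in iota X]sub0r (is_linearB iota_lin) (is_linear0 iota_lin) sub0r rnormN.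
rewrite (is_linearZ iota_lin) rnormZi.
rewrite (_ : C2 * h ^+ 2 = C2 * h * (h - 0)); last by rewrite subr0 expr2 mulrA.
apply: (rvintegral_image_norm_le iota c _ G 0 h (C2 * h) (M * b + M * b))
  hil0 hil1 iota_lin iota_bdd (ltW h0) GP _ _.
  move=> s sI; apply: le_trans (rnormB _ _) _; apply: lerD.
    by apply: F_le; exact: v_le.
  by rewrite rnormZ ler_pM ?rnorm_ge0 ?B_bdd ?lerDl//; exact: betaM.
move=> s sI; have [s0 sh] := andP sI.
have [vd vh] := v_near s sI.
rewrite -scalerBr (is_linearZ iota_lin) rnormZ /C2 -(mulrA M).
rewrite ler_pM ?rnorm_ge0//; first exact: betaM.
have := B_lip0 _ vd; rewrite (addrC u0) subrK => Bv.
have ss : `|sigma h s| <= M * h by rewrite sigmaM// s0.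
(* The first term is an isometric image, controlled by [B_lip0]; the second is the displacement of
   [B u0]. *)
have -> : iota (Phi1 (sigma h s) (B (v s)) - B u0) =
    Phi0 (sigma h s) (iota (B (v s)) - iota (B u0))
    + (Phi0 (sigma h s) (iota (B u0)) - iota (B u0)).
  case: gr0 => Phi0_lin _.
  by rewrite (is_linearB iota_lin) (is_linearB (Phi0_lin _)) addrA subrK agree.
apply: le_trans (rnorm_triangle _ _) _; rewrite (unitary_rnorm gr0).
have := Hc (sigma h s) (le_lt_trans ss Mhc).
have : Kc * `|sigma h s| <= Kc * (M * h) by rewrite ler_wpM2l.
have : Cd * rnorm (iota (v s - u0)) <= Cd * (C1 * h) by rewrite ler_wpM2l.
lra.
Qed.

End SplittingStep.

(** * Comparison of the exact and splitting steps *)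

Theorem mainTheorem11 (R : realType)
  (H0 H1 : completeNormedModType R[i])
  (ip0 : H0 -> H0 -> R[i]) (ip1 : H1 -> H1 -> R[i])
  (hil0 : is_hilbert ip0) (hil1 : is_hilbert ip1)
  (* continuous embedding H1 -> H0 *)
  (iota : H1 -> H0) (iota_lin : is_linear iota) (iota_inj : injective iota)
  (iota_bdd : exists c : R, forall x, `|iota x| <= c%:C * `|x|)
  (* A self-adjoint in H1, with self-adjoint extension in H0 *)
  (D1 : set H1) (A1 : H1 -> H1) (sa1 : selfadjoint ip1 D1 A1)
  (D0 : set H0) (A0 : H0 -> H0) (sa0 : selfadjoint ip0 D0 A0)
  (dom01 : forall x, D0 (iota x))
  (ext01 : forall x, D1 x -> A0 (iota x) = iota (A1 x))
  (* the unitary groups e^{-itA} on H1 and H0 *)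
  (Phi1 : R -> H1 -> H1) (Phi0 : R -> H0 -> H0)
  (gr1 : unitary_group_of D1 A1 Phi1) (gr0 : unitary_group_of D0 A0 Phi0)
  (agree : forall t x, Phi0 t (iota x) = iota (Phi1 t x))
  (* the nonlinearity *)
  (B : H1 -> H1)
  (B_loclip : forall r : R, exists L : R, forall u v,
      `|u| <= r%:C -> `|v| <= r%:C -> `|B u - B v| <= L%:C * `|u - v|)
  (B0 : B 0 = 0)
  (B' : H1 -> H0 -> H0) (B'_lin : forall u, is_linear (B' u))
  (condD : forall r eps : R, 0 < r -> 0 < eps ->
      exists C delta : R, 0 < C /\ 0 < delta /\
      forall u w, `|u| <= r%:C -> `|w| < delta%:C ->
        (forall x, `|B' u x| <= C%:C * `|x|) /\
        `|iota (B (u + w)) - iota (B u) - B' u (iota w)| <= eps%:C * `|iota w|)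
  (* splitting coefficients *)
  (alpha beta : R -> R)
  (alpha_ok : splitting_coef alpha) (beta_ok : splitting_coef beta)
  (u0 : H1)
  (* standing regularity assumption *)
  (reg : forall T' : R, 0 < T' -> (T'%:E < Tstar ip1 Phi1 B u0)%E ->
      (forall u, exact_sol ip1 Phi1 B u0 T' u -> W1inf T' (fun t => iota (u t)))
      /\ exists N : nat, forall n, (N <= n)%N ->
           (exists v, split_sol ip1 Phi1 B alpha beta T' n u0 T' v) /\
           (forall v, split_sol ip1 Phi1 B alpha beta T' n u0 T' v ->
              W1inf T' (fun t => iota (v t))))
  (T : R) (T_pos : 0 < T) (T_lt : (T%:E < Tstar ip1 Phi1 B u0)%E) :
  exists (C : R) (n0 : nat), 0 < C /\
    forall n : nat, (n0 <= n)%N ->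
    forall u v : R -> H1,
      exact_sol ip1 Phi1 B u0 (hstep T n) u ->
      split_sol ip1 Phi1 B alpha beta T n u0 (hstep T n) v ->
      `|iota (u (hstep T n)) - iota (v (hstep T n))|
        <= (C * hstep T n ^+ 2)%:C.
Proof.
have [c iotac] := iota_bdd.
have {}iota_bdd x : rnorm (iota x) <= c * rnorm x.
  by have := iotac x; rewrite !normE -rmorphM lecR.
pose r := rnorm u0 + 1.
have r0 : 0 < r by rewrite ltr_wpDl ?rnorm_ge0.
have [L BL] := B_loclip r.
(* Since [B 0 = 0], the Lipschitz bound on the ball of radius [r] bounds [B] there; the added 1
   makes [b] positive. *)
pose b := `|L| * r + 1.
have b0 : 0 < b by rewrite ltr_wpDl// mulr_ge0// ltW.
have B_bdd x : rnorm x <= rnorm u0 + 1 -> rnorm (B x) <= b.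
  move=> xr; have := BL x 0; rewrite B0 !subr0 normr0 norm_leE ler0c (ltW r0).
  move=> /(_ xr isT); rewrite !normE -rmorphM lecR => BxL.
  apply: le_trans BxL _; apply: le_trans (ler_norm _) _.
  rewrite normrM (ger0_norm (rnorm_ge0 _)).
  have : `|L| * rnorm x <= `|L| * r by rewrite ler_wpM2l.
  by rewrite /b; lra.
have [Cd [delta [Cd0 [delta0 D]]]] := condD r 1 r0 ltr01.
have u0r : rnorm u0 <= r by rewrite lerDl.
(* Condition (D) with [eps = 1] bounds the remainder, and [Cd] bounds the linear part [B' u0]. *)
have B_lip0 w : rnorm w < delta ->
    rnorm (iota (B (u0 + w)) - iota (B u0)) <= (Cd + 1) * rnorm (iota w).
  move=> wd; have := D u0 w; rewrite norm_leE norm_ltE => /(_ u0r wd) [/(_ (iota w))].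
  rewrite !normE mul1r -rmorphM !lecR => h1 h2.
  have := rnorm_triangle (iota (B (u0 + w)) - iota (B u0) - B' u0 (iota w)) (B' u0 (iota w)).
  by rewrite subrK; lra.
have Cd10 : 0 <= Cd + 1 by rewrite addr_ge0// ltW.
have step al be (al_ok : splitting_coef al) (be_ok : splitting_coef be) :=
  split_step_expansion hil0 hil1 iota_lin iota_bdd dom01 gr1 gr0 agree
    b0 Cd10 delta0 B_bdd B_lip0 al_ok be_ok T_pos.
have [C1 [n1 [C10 H_1]]] := step _ _ (splitting_coef1 R) (splitting_coef1 R).
have [C2 [n2 [C20 H_2]]] := step _ _ alpha_ok beta_ok.
(* The two expansion errors add up around the common point [e]; the extra 1 makes the constant
   positive. *)
exists (C1 + C2 + 1), (maxn n1 n2); split; first by rewrite ltr_wpDl// addr_ge0.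
move=> n; rewrite geq_max => /andP[n1n n2n] u v eu sv.
have := H_1 n n1n u (exact_sol_split ip1 Phi1 B T n u0 _ u eu).
have := H_2 n n2n v sv; rewrite norm_leE.
set h := hstep T n; set e := iota (Phi1 h u0 - _) => hv hu.
have := rnormB (iota (u h) - e) (iota (v h) - e).
rewrite opprB addrA subrK; have := sqr_ge0 h.
by lra.
Qed.
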